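(* Let a topological group $G$ be $\tau_g$-representable in a locally compact space $X$ ($(G,X,\theta)$ is a $G$-Tychonoff space). If (a) the family of maps $\theta^g:X\to X$, $\theta^g(x)=\theta(g,x)$, $g\in G$, is topologically equicontinuous, or (b) $X$ is a locally compact, locally connected space, then for the Alexandroff one-point $G$-compactification $\alpha X=X\cup\{\infty\}$ of $X$ the following condition (ER) holds: for all $R,S\in b_{\alpha X}G$, if $R\cap(X\times X)=S\cap(X\times X)\ne\emptyset$, then $R=S$. Hence $\imath_X^{\Gamma}:G\to(2^{X\times X},\tau_F)$ is an embedding and $b_{\alpha X}G=b_XG$.
   Context: All spaces are Tychonoff; maps are continuous; actions are effective. An equiuniformity on a $G$-space $X$ is a uniformity $\mathcal U$ inducing the topology of $X$ such that every $g\in G$ is uniformly continuous and for every uniform cover $u\in\mathcal U$ there are a neighbourhood $O$ of $e\in G$ and $v\in\mathcal U$ such that $\{OV\mid V\in v\}$ refines $u$. $X$ is $G$-Tychonoff if it has an equiuniformity. A group $G$ is representable in $X$ if it is a subgroup of the homeomorphism group of $X$. The $g$-topology $\tau_g$ on $G$ has as subbase the sets $[K,O]=\{g\in G\mid gK\subset O\}$, $K$ closed, $O$ open in $X$, with $K$ compact or $X\setminus O$ compact. A topological group $(G,\tau)$ is $\tau_g$-representable in $X$ if $G$ is representable in $X$, $\tau=\tau_g$, and $X$ is a $G$-Tychonoff space under the natural action. The action of $G$ extends to $\alpha X$ by fixing $\infty$, and $G$ is $\tau_g$-representable in $\alpha X$. A family $\mathcal F$ of maps $X\to Y$ is topologically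 equicontinuous if for all $x\in X$, $y\in Y$ and every neighbourhood $O_y$ of $y$ there are neighbourhoods $U_x$ of $x$ and $V_y$ of $y$ such that for every $f\in\mathcal F$: $f(U_x)\cap V_y\neq\emptyset$ implies $f(U_x)\subset O_y$. $2^{Z\times Z}$ is the set of all closed subsets of $Z\times Z$ (including $\emptyset$) with the Fell topology $\tau_F$, whose subbase is all sets $\{F\mid F\cap W\neq\emptyset\}$, $W$ open, and $\{F\mid F\cap K=\emptyset\}$, $K$ compact; it is compact Hausdorff for locally compact $Z$. For $G$ $\tau_g$-representable in $Z$ put $\imath_Z^{\Gamma}(g)=\{(z,gz)\mid z\in Z\}$ and let $b_ZG$ be the closure of $\imath_Z^{\Gamma}(G)$ in $(2^{Z\times Z},\tau_F)$. When $\imath_Z^\Gamma$ is a topological embedding, $b_ZG$ is a compactification of $G$ (graph compactification). Equality of compactifications of $G$ means existence of a homeomorphism between them commuting with the embeddings of $G$. *)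

(* Defs.v *)
From HB Require Import structures.
From mathcomp Require Import all_boot all_classical.
From mathcomp Require Import topology urysohn.

Set Implicit Arguments.
Unset Strict Implicit.
Unset Printing Implicit Defensive.

Local Open Scope classical_set_scope.

HB.mixin Record Group_isTopologicalGroup G & Group G & Topological G := {
  mulg_continuous : continuous (fun p : G * G => (p.1 * p.2)%g);
  invg_continuous : continuous (fun g : G => (g^-1)%g)
}.

#[short(type="topologicalGroupType")]
HB.structure Definition TopologicalGroup :=
  {G of Group G & Topological G & Group_isTopologicalGroup G}.

Definition tychonoff_space (T : topologicalType) : Prop :=
  hausdorff_space T /\ completely_regular_space T.

Definition tychonoff_hausdorff (T : topologicalType) (tT : tychonoff_space T) :
  hausdorff_space T := proj1 tT.

Definition locally_connected (T : topologicalType) : Prop :=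
  forall (x : T) (U : set T), nbhs x U ->
    exists V : set T, [/\ open V, V x, connected V & V `<=` U].

(* An effective action by homeomorphisms, i.e. an injective homomorphism into
   the homeomorphism group of Z (the inverse of rep_act g is rep_act g^-1). *)
Record representation (G : groupType) (Z : topologicalType) := Representation {
  rep_act :> G -> Z -> Z;
  rep_act1 : forall z, rep_act 1%g z = z;
  rep_actM : forall g h z, rep_act (g * h)%g z = rep_act g (rep_act h z);
  rep_act_effective : forall g, (forall z, rep_act g z = z) -> g = 1%g;
  rep_act_continuous : forall g, continuous (rep_act g)
}.

(* Alias of G whose canonical topology is the g-topology of theta. *)
Definition g_topology (G : groupType) (Z : topologicalType)
  (theta : representation G Z) : Type := G.

Definition g_subbase (G : groupType) (Z : topologicalType)
    (theta : representation G Z) : set (set (g_topology theta)) :=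
  [set W | exists K O : set Z,
    [/\ closed K, open O, compact K \/ compact (~` O) &
        W = [set g | theta g @` K `<=` O]]].

HB.instance Definition _ (G : groupType) (Z : topologicalType)
  (theta : representation G Z) := Choice.copy (g_topology theta) G.
HB.instance Definition _ (G : groupType) (Z : topologicalType)
    (theta : representation G Z) :=
  isSubBaseTopological.Build (g_topology theta) (@g_subbase G Z theta) id.

(* A cover is uniform for an entourage uniformity when it is refined by
   the cover by the balls E[x] of some entourage E. *)
Definition uniform_cover (U : uniformType) (u : set (set U)) : Prop :=
  exists2 E : set (U * U), entourage E &
    forall x, exists2 W, u W & xsection E x `<=` W.

Definition refines (T : Type) (v u : set (set T)) : Prop :=
  forall V, v V -> exists2 W, u W & V `<=` W.

Definition equiuniformity (G : topologicalGroupType) (X : topologicalType)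
    (theta : representation G X) (mU : Uniform.axioms_ X) : Prop :=
  let U : uniformType := Uniform.Pack mU in
  [/\ @nbhs U U = @nbhs X X,
      forall g, @unif_continuous U U (theta g) &
      forall u : set (set U), uniform_cover u ->
        exists (O : set G) (v : set (set U)),
          [/\ nbhs (1%g : G) O, uniform_cover v &
              refines
                [set [set theta g x | g in O & x in V] | V in v] u]].

Definition G_tychonoff (G : topologicalGroupType) (X : topologicalType)
    (theta : representation G X) : Prop :=
  continuous (fun p : G * X => theta p.1 p.2) /\
  exists mU : Uniform.axioms_ X, equiuniformity theta mU.

Definition tau_g_representable (G : topologicalGroupType) (X : topologicalType)
    (theta : representation G X) : Prop :=
  (forall W : set G, open W <-> @open (g_topology theta) W) /\
  G_tychonoff theta.

Definition topologically_equicontinuous (X Y : topologicalType)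
    (F : set (X -> Y)) : Prop :=
  forall (x : X) (y : Y) (Oy : set Y), nbhs y Oy ->
    exists (Ux : set X) (Vy : set Y),
      [/\ nbhs x Ux, nbhs y Vy &
          forall f, F f -> (f @` Ux) `&` Vy !=set0 -> f @` Ux `<=` Oy].

Record hyperspace (T : topologicalType) := Hyperspace {
  hyperset :> set T;
  hyperset_closed : closed hyperset
}.

HB.instance Definition _ (T : topologicalType) := gen_eqMixin (hyperspace T).
HB.instance Definition _ (T : topologicalType) :=
  gen_choiceMixin (hyperspace T).

Definition fell_subbase (T : topologicalType) : set (set (hyperspace T)) :=
  [set N |
    (exists2 W : set T, open W & N = [set F : hyperspace T | F `&` W !=set0]) \/
    (exists2 K : set T, compact K & N = [set F : hyperspace T | F `&` K = set0])].

HB.instance Definition _ (T : topologicalType) :=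
  isSubBaseTopological.Build (hyperspace T) (@fell_subbase T) id.

Lemma graph_closed (Z : topologicalType) (f : Z -> Z) :
  hausdorff_space Z -> continuous f -> closed [set p : Z * Z | p.2 = f p.1].
Proof.
move=> hZ cf [x y] clxy /=; apply: hZ => A B Ay Bfx.
have nb : nbhs (x, y) (f @^-1` B `*` A).
  by exists (f @^-1` B, A) => //; split => //; exact: cf.
by have [[a b] /= [-> [Bfa Aa]]] := clxy _ nb; exists (f a).
Qed.

Definition graph_map (G : groupType) (Z : topologicalType)
    (hZ : hausdorff_space Z) (theta : representation G Z) (g : G) :
    hyperspace (Z * Z)%type :=
  Hyperspace (graph_closed hZ (@rep_act_continuous _ _ theta g)).

Definition graph_closure (G : groupType) (Z : topologicalType)
    (hZ : hausdorff_space Z) (theta : representation G Z) :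
    set (hyperspace (Z * Z)%type) :=
  closure (range (graph_map hZ theta)).

Definition graph_compactification_map (G : groupType) (Z : topologicalType)
    (hZ : hausdorff_space Z) (theta : representation G Z) (g : G) :
    set_type (graph_closure hZ theta) :=
  exist _ (graph_map hZ theta g)
    (mem_set (subset_closure (imageT (graph_map hZ theta) g))).

Definition topological_embedding (S T : topologicalType) (f : S -> T) : Prop :=
  injective f /\
  forall U : set S, open U <-> exists2 V : set T, open V & f @^-1` V = U.

Definition homeomorphism (S T : topologicalType) (h : S -> T) : Prop :=
  continuous h /\
  exists k : T -> S, [/\ continuous k, cancel h k & cancel k h].

Definition same_compactification (G K L : topologicalType)
    (i : G -> K) (j : G -> L) : Prop :=
  exists2 h : K -> L, homeomorphism h & forall g, h (i g) = j g.

(* When X is compact the added point None is isolated. *)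
Notation alpha X := (one_point_compactification X).

Section alpha_representation.
Variables (G : groupType) (X : topologicalType) (theta : representation G X).

Definition alpha_act (g : G) (z : alpha X) : alpha X := omap (theta g) z.

Lemma alpha_act1 z : alpha_act 1%g z = z.
Proof. by case: z => //= x; rewrite /alpha_act /= rep_act1. Qed.

Lemma alpha_actM g h z :
  alpha_act (g * h)%g z = alpha_act g (alpha_act h z).
Proof. by case: z => //= x; rewrite /alpha_act /= rep_actM. Qed.

Lemma alpha_act_effective g : (forall z, alpha_act g z = z) -> g = 1%g.
Proof.
by move=> H; apply: (@rep_act_effective _ _ theta) => x; have [] := H (Some x).
Qed.

Lemma alpha_act_continuous g : continuous (alpha_act g).
Proof.
move=> [x|] A.
  by move=> nA; apply: (@rep_act_continuous _ _ theta g x (Some @^-1` A)).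
case=> C [cptC cloC] sA; exists (theta g @^-1` C).
  split; last by apply: (preimage_closed _ cloC) => y _; exact: rep_act_continuous.
  have -> : theta g @^-1` C = theta (g^-1)%g @` C.
    apply/seteqP; split => [y /= Cy|_ [y Cy <-] /=].
      by exists (theta g y) => //; rewrite -rep_actM mulVg rep_act1.
    by rewrite -rep_actM mulgV rep_act1.
  apply: continuous_compact cptC; apply: continuous_subspaceT.
  exact: rep_act_continuous.
move=> [y|] /= H; apply: sA; last by right.
by case: H => // -[y' nCy [<-]]; left; exists (theta g y').
Qed.

Definition alpha_representation : representation G (alpha X) :=
  Representation alpha_act1 alpha_actM alpha_act_effective alpha_act_continuous.

End alpha_representation.

Definition alpha_hausdorff (X : topologicalType)
    (lcX : locally_compact [set: X]) (tX : tychonoff_space X) :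
    hausdorff_space (alpha X) :=
  one_point_compactification_hausdorff lcX (tychonoff_hausdorff tX).

Definition finite_part (X : topologicalType) : set (alpha X * alpha X) :=
  range (@Some X) `*` range (@Some X).

Arguments finite_part X : clear implicits.

Definition condition_ER (G : groupType) (X : topologicalType)
    (haX : hausdorff_space (alpha X)) (theta : representation G X) : Prop :=
  forall R S : hyperspace (alpha X * alpha X)%type,
    graph_closure haX (alpha_representation theta) R ->
    graph_closure haX (alpha_representation theta) S ->
    R `&` finite_part X = S `&` finite_part X ->
    R `&` finite_part X !=set0 ->
    R = S.

(* Main.v *)
(* Restriction to X x X is a Fell-continuous map from b_(alpha X) G onto b_X G.
   It is injective: if (x, oo) belongs to a limit R of graphs, then either R has
   no finite point over x, or (x, oo) is a limit of finite points of R.  Under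
   equicontinuity a limit of graphs has only one point over x as soon as it has
   a finite one.  Under local connectedness, the image of a small connected
   neighbourhood of x under an approximating homeomorphism that comes both close
   to oo and close to a finite point must cross the compact boundary of any small
   neighbourhood of oo.  The points (oo, y) are treated by swapping coordinates,
   that is, by inverting the group elements.  A continuous bijection between
   compact Hausdorff spaces is a homeomorphism, and the g-topology is read off
   from the graphs in alpha X, where K x (X \ O) is contained in a compact set
   even when only one of the two factors is compact. *)
Require Import Defs.
From HB Require Import structures.
From mathcomp Require Import all_boot all_classical.
From mathcomp Require Import topology urysohn.

Set Implicit Arguments.
Unset Strict Implicit.
Unset Printing Implicit Defensive.

Local Open Scope classical_set_scope.

(** * The Fell topology *)

(** Stated for an arbitrary subbase [b], so that it serves both the Fell topology and the
    $g$-topology. *)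
Lemma subbase_cvg (T : topologicalType) (b : set_system T)
    (F : set_system T) (p : T) :
  Filter F ->
  (forall U, open U -> exists2 D, D `<=` finI_from b id & \bigcup_(i in D) i = U) ->
  (forall N, b N -> N p -> F N) -> F --> p.
Proof.
move=> FF bT bF A; rewrite /= nbhsE => -[U [/bT[D Db <-] [V DV Vp]] UA].
suff FV : F V by apply: filterS FV => q Vq; apply: UA; exists V.
have [I Ib IV] := Db V DV.
rewrite -IV; apply: filter_bigI => N IN; apply: bF; first exact/set_mem/Ib.
by move: Vp; rewrite -IV; apply.
Qed.

Lemma fell_cvg (T : topologicalType) (F : set_system (hyperspace T))
    (R : hyperspace T) :
  Filter F ->
  (forall W, open W -> R `&` W !=set0 -> F [set S : hyperspace T | S `&` W !=set0]) ->
  (forall K, compact K -> R `&` K = set0 -> F [set S : hyperspace T | S `&` K = set0]) ->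
  F --> R.
Proof.
move=> FF Fhit Fmiss; apply: (@subbase_cvg _ (@fell_subbase T)).
  by move=> U [D' ? ?]; exists D'.
by move=> N [[W oW ->]|[K cK ->]]; [exact: Fhit|exact: Fmiss].
Qed.

Lemma fell_subbase_open (T : topologicalType) (N : set (hyperspace T)) :
  @fell_subbase T N -> open N.
Proof.
move=> bN; exists [set N]; last by rewrite bigcup_set1.
move=> _ ->; exact: finI_from1.
Qed.

Lemma hit_open (T : topologicalType) (W : set T) :
  open W -> open [set R : hyperspace T | R `&` W !=set0].
Proof. by move=> oW; apply: fell_subbase_open; left; exists W. Qed.

Lemma miss_open (T : topologicalType) (K : set T) :
  compact K -> open [set R : hyperspace T | R `&` K = set0].
Proof. by move=> cK; apply: fell_subbase_open; right; exists K. Qed.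

Lemma hyperspace_eq (T : topologicalType) (R S : hyperspace T) :
  R = S :> set T -> R = S.
Proof. case: R S => [R cR] [S cS] /= e; subst; congr Hyperspace; exact: Prop_irrelevance. Qed.

Lemma g_topology_cvg (G : groupType) (Z : topologicalType)
    (theta : representation G Z) (F : set_system (g_topology theta)) g :
  Filter F ->
  (forall K O, closed K -> open O -> compact K \/ compact (~` O) ->
     theta g @` K `<=` O -> F [set h | theta h @` K `<=` O]) ->
  F --> (g : g_topology theta).
Proof.
move=> FF FKO; apply: (@subbase_cvg _ (@g_subbase G Z theta)).
  by move=> U [D' ? ?]; exists D'.
by move=> N [K [O [cK oO KO ->]]]; exact: FKO.
Qed.

(** An ultrafilter [F] converges to the set [L] of points whose open neighbourhoods are all hit by
    [F]-almost every set. Hit conditions hold by the choice of [L]. If [L] misses a compact [K],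
    each point of [K] has a neighbourhood missed by [F]-almost every set, and compactness makes this
    uniform over [K]. *)
Lemma fell_compact (T : topologicalType) : compact [set: hyperspace T].
Proof.
rewrite compact_ultra => F FU _.
have FF : ProperFilter F by exact: ultra_proper.
pose L := [set z : T | forall W, open W -> W z -> F [set R : hyperspace T | R `&` W !=set0]].
have cL : closed L.
  move=> z clz W oW Wz.
  have [t [Lt Wt]] := clz W (open_nbhs_nbhs (conj oW Wz)).
  exact: Lt.
exists (Hyperspace cL); split => //; apply: fell_cvg => [W oW [z [Lz Wz]]|K cK LK].
  exact: Lz.
have cov z : K z -> \forall y \near z & R \near F, ~ hyperset R y.
  move=> Kz; have /existsNP[W /not_implyP[oW /not_implyP[Wz nFW]]] : ~ L z.
    by move=> Lz; move: LK => /seteqP[/(_ z (conj Lz Kz))].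
  exists (W, [set R : hyperspace T | ~ (R `&` W !=set0)]).
    split => /=; first exact: open_nbhs_nbhs.
    by have [|//] := in_ultra_setVsetC [set R : hyperspace T | R `&` W !=set0] FU.
  by move=> [y R] /= [Wy nRW] Ry; apply: nRW; exists y.
have := (compact_near_coveringP K).1 cK _ F (fun R y => ~ hyperset R y) FF cov.
by apply: filterS => R KR; apply/seteqP; split=> // y [Ry /KR].
Qed.

(** A point of one set outside the other has a compact neighbourhood missing the latter. Hitting its
    interior and missing the compact set are disjoint open conditions. *)
Lemma fell_hausdorff (T : topologicalType) :
  hausdorff_space T -> locally_compact [set: T] -> hausdorff_space (hyperspace T).
Proof.
move=> hT lcT R S clRS.
have sub (R' S' : hyperspace T) : cluster (nbhs R') S' -> R' `<=` S'.
  move=> cl z R'z; apply: contrapT => nS'z.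
  have nbS : nbhs z (~` (S' : set T)).
    by apply: open_nbhs_nbhs; split => //; apply: closed_openC; exact: hyperset_closed.
  have [C nC [cC _]] := lcT z I; rewrite withinET in nC.
  have [B nB clB] := compact_regular hT cC nC nbS.
  have nBC : nbhs z (B `&` C)° by apply: nbhs_interior; exact: filterI.
  have cK : compact (closure B `&` C).
    by rewrite setIC; apply: compact_closedI => //; exact: closed_closure.
  have h1 : nbhs R' [set Q : hyperspace T | Q `&` (B `&` C)° !=set0].
    apply: open_nbhs_nbhs; split; first exact: hit_open (open_interior _).
    by exists z; split => //; exact: nbhs_singleton.
  have h2 : nbhs S' [set Q : hyperspace T | Q `&` (closure B `&` C) = set0].
    apply: open_nbhs_nbhs; split; first exact: miss_open.
    by apply/seteqP; split => // y [S'y [/clB]].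
  have [Q [/= [y [Qy /interior_subset[By Cy]]] /seteqP[Q0 _]]] := cl _ _ h1 h2.
  by apply: (Q0 y); split => //; split => //; exact: subset_closure.
apply: hyperspace_eq; apply/seteqP; split; first exact: sub.
apply: sub => A B nA nB; rewrite setIC; exact: clRS.
Qed.

(** Restriction to $X\times X$ and exchange of coordinates are both instances. *)
Definition pullback (S T : topologicalType) (j : S -> T) (cj : continuous j)
    (R : hyperspace T) : hyperspace S :=
  Hyperspace (preimage_closed (fun x _ => cj x) (@hyperset_closed _ R)).

Lemma pullback_continuous (S T : topologicalType) (j : S -> T) (cj : continuous j) :
  (forall W, open W -> open (j @` W)) -> continuous (pullback cj).
Proof.
have imI (R : set T) A : R `&` (j @` A) !=set0 <-> j @^-1` R `&` A !=set0.
  split=> [[z [Rz [y Ay yz]]]|[y [Ry Ay]]]; first by exists y; rewrite /= yz.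
  by exists (j y); split => //; exists y.
move=> oj R; apply: fell_cvg => [|W oW /imI RW|K cK RK]; first exact: (fmap_filter _ (nbhs_filter R)).
  apply: (filterS (P := [set Q : hyperspace T | Q `&` (j @` W) !=set0])).
    by move=> Q /imI.
  by apply: open_nbhs_nbhs; split => //; apply/hit_open/oj.
apply: (filterS (P := [set Q : hyperspace T | Q `&` (j @` K) = set0])).
  by move=> Q /= QK; apply: contrapT => /eqP/set0P/imI/set0P; rewrite QK eqxx.
apply: open_nbhs_nbhs; split; last first.
  by apply: contrapT => /eqP/set0P/imI/set0P; rewrite RK eqxx.
apply: miss_open; apply: continuous_compact cK; exact: continuous_subspaceT.
Qed.

Lemma open_setX (S T : topologicalType) (A : set S) (B : set T) :
  open A -> open B -> open (A `*` B).
Proof.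
move=> oA oB; rewrite openE => -[a b] [/= Aa Bb].
by exists (A, B) => //; split; exact: open_nbhs_nbhs.
Qed.

Lemma swap_open (S T : topologicalType) (W : set (S * T)) :
  open W -> open (@swap_pair S T @` W).
Proof.
move=> oW; suff -> : @swap_pair S T @` W = @swap_pair T S @^-1` W.
  by apply: open_comp oW => x _; exact: (@swap_continuous T S).
by apply/seteqP; split=> [_ [[a b] Wab <-]//|[b a] /= Wab]; exists (a, b).
Qed.

(** * Limits of graphs *)

Section graph_closure.
Variables (G : groupType) (Z : topologicalType) (hZ : hausdorff_space Z).
Variable theta : representation G Z.
Implicit Types R : hyperspace (Z * Z)%type.

Lemma graph_closure_open R (N : set (hyperspace (Z * Z)%type)) :
  graph_closure hZ theta R -> open N -> N R -> exists g, N (graph_map hZ theta g).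
Proof.
move=> clR oN NR; have [_ [[g _ <-] Ng]] := clR N (open_nbhs_nbhs (conj oN NR)).
by exists g.
Qed.

(** Missing the compact fibre over [x] is an open condition that no graph satisfies. *)
Lemma graph_closure_total R x :
  compact [set: Z] -> graph_closure hZ theta R -> exists y, hyperset R (x, y).
Proof.
move=> cZ clR; apply: contrapT => /forallNP nR.
have [||g /=] := graph_closure_open clR (@miss_open _ ([set x] `*` [set: Z]) _).
- by apply: compact_setX => //; exact: compact_set1.
- by apply/seteqP; split=> // -[z y] /= [+ [zx _]]; rewrite zx; exact: nR.
- by move=> /seteqP[/(_ (x, theta g x))] /=; case.
Qed.

(** Exchanging coordinates is continuous on the hyperspace and turns the graph of [g] into that of
    its inverse. *)
Lemma graph_closure_swap R :
  graph_closure hZ theta R ->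
  graph_closure hZ theta (pullback (@swap_continuous Z Z : continuous swap_pair) R).
Proof.
move=> clR B nB.
have [_ [[g _ <-] Bg]] := clR _ (pullback_continuous (@swap_open Z Z) nB).
exists (graph_map hZ theta g^-1); split; first by exists (g^-1)%g.
suff -> : graph_map hZ theta g^-1 =
          pullback (@swap_continuous Z Z : continuous swap_pair) (graph_map hZ theta g) by [].
apply: hyperspace_eq; apply/seteqP; split=> -[a b] /= ->.
  by rewrite -rep_actM mulgV rep_act1.
by rewrite -rep_actM mulVg rep_act1.
Qed.

End graph_closure.

(** * Limits of graphs at the point at infinity *)

Section infinity.
Variables (G : groupType) (X : topologicalType).
Hypothesis (hX : hausdorff_space (alpha X)).
Variable theta : representation G X.
Implicit Types R S : hyperspace (alpha X * alpha X)%type.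

Local Notation clG := (graph_closure hX (alpha_representation theta)).

Lemma graph_closure_infty R : clG R -> hyperset R (None, None).
Proof.
move=> clR; apply: contrapT => nR.
have [||g /=] := graph_closure_open clR (@miss_open _ [set (None, None) : alpha X * alpha X] _).
- exact: compact_set1.
- by apply/seteqP; split=> // p [/= + pE]; rewrite pE.
- by move=> /seteqP[/(_ (None, None))] /=; case.
Qed.

(** Separate [Some y] and [z] by disjoint [A] and [B]. A graph close to [R] sends one point of [U]
    into [V] and another into [B], but the first fact forces the whole image of [U] into [A]. *)
Lemma equicontinuous_single_valued R x y z :
  topologically_equicontinuous (range theta) -> clG R ->
  hyperset R (Some x, Some y) -> hyperset R (Some x, z) -> z = Some y.
Proof.
move=> eqc clR Rxy Rxz; apply/esym; move: hX; rewrite open_hausdorff => h.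
apply: contrapT => /eqP/h[[A B] /= [/set_mem Ay /set_mem Bz] [oA oB AB]].
have nA : nbhs (Some y : alpha X) A by exact: open_nbhs_nbhs.
have [U [V [nU nV UV]]] := eqc x y (Some @^-1` A) nA.
pose U' : set (alpha X) := Some @` U°; pose V' : set (alpha X) := Some @` V°.
have oU' : open U'.
  by apply: one_point_compactification_open_some; exact: open_interior.
have oV' : open V'.
  by apply: one_point_compactification_open_some; exact: open_interior.
have [|g [[[a b] [/= ->]] [[u Uu <-] [v Vv [gu]]]]] := graph_closure_open clR
    (openI (hit_open (open_setX oU' oV')) (hit_open (open_setX oU' oB))).
  split; first by exists (Some x, Some y); split => //; split; [exists x|exists y].
  by exists (Some x, z); split => //; split => //; exists x.
move=> [[_ c] [/= ->]] [[w Uw <-] Bgw].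
have Agw : A (Some (theta g w)).
  apply: (UV (theta g)) => //; last by exists w => //; exact: interior_subset.
  by exists v; split; [exists u => //; exact: interior_subset|exact: interior_subset].
have : (A `&` B) (Some (theta g w)) by [].
by rewrite (eqP AB).
Qed.

Lemma locally_connected_infty_closure R x y :
  locally_connected X -> clG R ->
  hyperset R (Some x, Some y) -> hyperset R (Some x, None) ->
  closure (R `&` finite_part X) (Some x, None).
Proof.
move=> lc clR Rxy Rxo D [[U1 N0] [/= nU1 nN0] /= UN].
have cX : compact [set: alpha X] := one_point_compactification_compact.
apply: contrapT => nD.
(* Cutting down to finite points keeps the closure of the later [U] away from infinity. *)
pose U0 := U1 `&` range Some.
have nU0 : nbhs (Some x : alpha X) U0.
  apply: filterI => //.
  exact: (@one_point_compactification_some_nbhs X x setT filterT).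
have {UN}nR a b : U0 (Some a) -> N0 (Some b) -> ~ hyperset R (Some a, Some b).
  move=> [Ua _] Nb Rab; apply: nD; exists (Some a, Some b); split; last exact: UN.
  by split.
have [V nV VU] := compact_regular hX cX filterT nU0.
have [C [oC Cx cC CV]] := lc x (Some @^-1` V) nV.
have [N1 nN1 N1N0] := compact_regular hX cX filterT nN0.
pose N := N1°; have oN : open N := open_interior N1.
have nN1N : N None by exact: nbhs_singleton (nbhs_interior nN1).
have NN0 : closure N `<=` N0.
  by apply: subset_trans N1N0; apply: closureS; exact: interior_subset.
pose U : set (alpha X) := Some @` C.
have UU0 : closure U `<=` U0.
  by apply: subset_trans VU; apply: closureS => _ [c Cc <-]; exact: CV.
have oU : open U by exact: one_point_compactification_open_some.
have oN' : open (~` closure N) by apply: closed_openC; exact: closed_closure.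
(* The second factor is the boundary of the open set [N]. It consists of finite points of [N0], so
   [R] misses this product, while it hits [U] times [N] and [U] times the exterior of [N]. *)
have cB : compact (closure U `*` (closure N `\` N)).
  apply: compact_setX; apply: subclosed_compact cX _ => //.
    exact: closed_closure.
  by rewrite setDE; apply: closedI; [exact: closed_closure|exact: open_closedC].
have [|g [[]]] := graph_closure_open clR
    (openI (openI (hit_open (open_setX oU oN)) (hit_open (open_setX oU oN')))
           (miss_open cB)).
  split; [split|].
  - exists (Some x, None); split => //; split; first by exists x.
    exact: nN1N.
  - exists (Some x, Some y); split => //; split; first by exists x.
    move=> /NN0 Ny; apply: (nR x y) => //; exact: nbhs_singleton nU0.
  - apply/seteqP; split => // -[a [b|]] [/= Rab [/= /UU0 Ua [/NN0 Nb nNb]]].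
      by move: Rab (Ua); case: Ua => _ [a' _ <-] Rab Ua; exact: nR Rab.
    by apply: nNb; exact: nN1N.
move=> [[a b] [/= ->]] [[u Cu <-] Ngu] [[c d] [/= ->]] [[v Cv <-] Ngv] miss.
have ct : continuous (Some \o theta g : X -> alpha X).
  move=> z; apply: continuous_comp; first exact: rep_act_continuous.
  exact: one_point_compactification_some_continuous.
(* The image of [C] under [g] avoids the boundary of [N], so the preimage of [N] is clopen in [C].
   It contains [u], so connectedness makes it all of [C], although [v] is sent outside. *)
suff E : C `&` (Some \o theta g) @^-1` N = C.
  have Nv : N (Some (theta g v)) by move: Cv; rewrite -{1}E => -[].
  exact: (Ngv (subset_closure Nv)).
apply: cC; first by exists u.
  by exists ((Some \o theta g) @^-1` N) => //; apply: open_comp oN => z _; exact: ct.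
exists ((Some \o theta g) @^-1` closure N).
  exact: (preimage_closed (fun z _ => ct z) (@closed_closure _ N)).
apply/seteqP; split=> z [Cz Nz]; split=> //; first exact: subset_closure.
apply: contrapT => nNz; case/seteqP: miss => /(_ (Some z, Some (theta g z))) + _.
by apply; split => //; split => //; apply: subset_closure; exists z.
Qed.

End infinity.

(** * Compact Hausdorff subspaces, products and continuity of the graph map *)

Lemma set_type_compact (T : topologicalType) (A : set T) :
  compact A -> compact [set: set_type A].
Proof.
move=> cA F FF _; have [|p [Ap clp]] := cA (set_val @ F) _.
  by apply: (@filterS _ F _ setT) filterT => x _; exact: set_valP.
exists (exist _ p (mem_set Ap)); split=> // B U FB.
rewrite nbhsE => -[_ [[V oV <-] Vp] VU].
have [||_ [[x Bx <-] Vx]] := clp (set_val @` B) V.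
- by apply: (@filterS _ F _ B) FB => x Bx; exists x.
- exact: open_nbhs_nbhs.
by exists x; split=> //; exact: VU.
Qed.

Lemma set_type_hausdorff (T : topologicalType) (A : set T) :
  hausdorff_space T -> hausdorff_space (set_type A).
Proof.
move=> hT p q clpq; apply/val_inj/hT => U V nU nV.
have [] := clpq (set_val @^-1` U) (set_val @^-1` V).
- exact: (@initial_continuous _ _ set_val p).
- exact: (@initial_continuous _ _ set_val q).
by move=> r [Ur Vr]; exists (set_val r).
Qed.

Lemma compact_hausdorff_homeomorphism (S T : topologicalType) (h : S -> T) :
  compact [set: S] -> hausdorff_space T -> continuous h ->
  injective h -> (forall y, exists x, h x = y) -> homeomorphism h.
Proof.
move=> cS hT ch ih /choice[k hk]; split=> //; exists k.
have kh : cancel h k by move=> x; apply: ih.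
split=> //; apply/continuous_closedP => A cA.
have -> : k @^-1` A = h @` A.
  apply/seteqP; split=> [y Ay|_ [x Ax <-]]; first by exists (k y).
  by rewrite /= kh.
apply: compact_closed => //; apply: continuous_compact.
  exact: continuous_subspaceT.
exact: subclosed_compact cA cS _.
Qed.

Lemma graph_map_continuous (G : topologicalGroupType) (Z : topologicalType)
    (hZ : hausdorff_space Z) (theta : representation G Z) :
  continuous (fun p : G * Z => theta p.1 p.2) ->
  continuous (graph_map hZ theta : G -> _).
Proof.
move=> ct g; apply: fell_cvg => [W oW [[x y] [/= yx Wx]]|K cK gK].
  rewrite {}yx in Wx.
  have [[A B] /= [nA nB] AB] : nbhs (x, theta g x) W by exact: open_nbhs_nbhs.
  have [[O U] /= [nO nU] OU] := ct (g, x) B nB.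
  apply: (@filterS _ (nbhs g) _ O) nO => h Oh; exists (x, theta h x); split=> //.
  apply: AB; split; first exact: nbhs_singleton nA.
  by apply: (OU (h, x)); split => //; exact: nbhs_singleton nU.
(* Joint continuity of the action keeps [theta h q.1] in a neighbourhood disjoint from one of [p.2].
   Compactness of [K] then gives one neighbourhood of [g] for all its points. *)
have nearK p : K p -> \forall q \near p & h \near g, q.2 <> theta h q.1.
  move=> Kp; have /eqP pg : p.2 <> theta g p.1.
    by move=> pg; case/seteqP: gK => /(_ p) + _; apply.
  have := hZ; rewrite open_hausdorff => /(_ _ _ pg).
  move=> [[A B] /= [/set_mem Ap /set_mem Bp] [oA oB /eqP AB]].
  have [[O U] /= [nO nU] OU] := ct (g, p.1) B (open_nbhs_nbhs (conj oB Bp)).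
  exists ((U `*` A), O).
    split => //; exists (U, A) => //; split => //; exact: open_nbhs_nbhs.
  move=> [q h] /= [[Uq Aq] Oh] qh.
  have : (A `&` B) q.2 by split=> //; rewrite qh; exact: (OU (h, q.1)).
  by rewrite AB.
have gK' := (compact_near_coveringP K).1 cK G (nbhs g)
  (fun h q => q.2 <> theta h q.1) (nbhs_filter g) nearK.
by apply: (@filterS _ (nbhs g)) gK' => h hK; apply/seteqP; split=> // q [/= qh /hK].
Qed.

Lemma locally_compact_setX (S T : topologicalType) :
  locally_compact [set: S] -> locally_compact [set: T] ->
  locally_compact [set: (S * T)%type].
Proof.
move=> lS lT [x y] _; rewrite withinET.
have [A nA [cA clA]] := lS x I; have [B nB [cB clB]] := lT y I.
rewrite !withinET in nA nB.
exists (A `*` B); first by exists (A, B).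
split; first exact: compact_setX.
by apply: closedI; apply: preimage_closed => // z _; [exact: cvg_fst|exact: cvg_snd].
Qed.

Lemma hausdorff_setX (S T : topologicalType) :
  hausdorff_space S -> hausdorff_space T -> hausdorff_space (S * T)%type.
Proof.
move=> hS hT [a b] [c d] cl; congr pair.
  apply: hS => A B nA nB.
  have [||[x y] [[Ax _] [Bx _]]] := cl (A `*` setT) (B `*` setT); last by exists x.
    by exists (A, setT) => //; split=> //; exact: filterT.
  by exists (B, setT) => //; split=> //; exact: filterT.
apply: hT => A B nA nB.
have [||[x y] [[_ Ay] [_ By]]] := cl (setT `*` A) (setT `*` B); last by exists y.
  by exists (setT, A) => //; split=> //; exact: filterT.
by exists (setT, B) => //; split=> //; exact: filterT.
Qed.

(** * Restriction of limits of graphs to the finite part *)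

Section alpha.
Variables (G : groupType) (X : topologicalType).

Definition some_pair (p : X * X) : alpha X * alpha X := (Some p.1, Some p.2).

Lemma some_pair_continuous : continuous some_pair.
Proof.
move=> p W [[A B] /= [nA nB] AB].
exists (Some @^-1` A, Some @^-1` B) => // q [/= Aq Bq].
exact: (AB (Some q.1, Some q.2)).
Qed.

Lemma some_pair_open (W : set (X * X)) : open W -> open (some_pair @` W).
Proof.
rewrite !openE => oW _ [p Wp <-].
have [[A B] /= [nA nB] AB] := oW p Wp.
exists (Some @` A, Some @` B).
  by split; exact: one_point_compactification_some_nbhs.
by move=> [_ _] [/= [a Aa <-] [b Bb <-]]; exists (a, b) => //; exact: AB.
Qed.

Variables (lcX : locally_compact [set: X]) (tX : tychonoff_space X).
Variable theta : representation G X.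
Implicit Types R S : hyperspace (alpha X * alpha X)%type.

Local Notation hA := (alpha_hausdorff lcX tX).
Local Notation hX := (tychonoff_hausdorff tX).
Local Notation rho := (pullback some_pair_continuous).
Local Notation clA := (graph_closure hA (alpha_representation theta)).
Local Notation clX := (graph_closure hX theta).

Lemma pullback_graph_map g :
  rho (graph_map hA (alpha_representation theta) g) = graph_map hX theta g.
Proof.
apply: hyperspace_eq; apply/seteqP; split=> -[x y] /=; last by move=> ->.
by move=> [].
Qed.

Lemma hyperspace_setX_hausdorff : hausdorff_space (hyperspace (X * X)%type).
Proof.
apply: fell_hausdorff; first exact: (hausdorff_setX hX hX).
exact: (locally_compact_setX lcX lcX).
Qed.

Lemma graph_closure_compact : compact clA.
Proof.
by apply: subclosed_compact (@fell_compact _) _ => //; exact: closed_closure.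
Qed.

(** Restriction is a closed map on the compact set [clA], since its target is Hausdorff. *)
Lemma pullback_closed (C : set (hyperspace (alpha X * alpha X)%type)) :
  closed C -> closed (rho @` (clA `&` C)).
Proof.
move=> cC; apply: compact_closed; first exact: hyperspace_setX_hausdorff.
apply: continuous_compact.
  by apply: continuous_subspaceT; exact: (pullback_continuous some_pair_open).
by apply: compact_closedI => //; exact: graph_closure_compact.
Qed.

(** Continuity gives one inclusion. For the other, the image is closed and contains all graphs. *)
Lemma pullback_image_closure : rho @` clA = clX.
Proof.
apply/seteqP; split=> [_ [R clR <-] B nB|R clR].
  have [_ [[g _ <-] Bg]] := clR _ (pullback_continuous some_pair_open nB).
  exists (graph_map hX theta g); split; first by exists g.
  by rewrite -pullback_graph_map.
have := pullback_closed (@closedT _); rewrite setIT => /closure_id ->.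
apply: closureS clR => _ [g _ <-].
exists (graph_map hA (alpha_representation theta) g).
  by apply: subset_closure; exists g.
exact: pullback_graph_map.
Qed.

Lemma infty_closure R x y :
  topologically_equicontinuous (range theta) \/ locally_connected X ->
  clA R -> hyperset R (Some x, Some y) -> hyperset R (Some x, None) ->
  closure (R `&` finite_part X) (Some x, None).
Proof.
move=> [eqc|lc] clR Rxy Rxo; last first.
  exact: (locally_connected_infty_closure lc clR Rxy Rxo).
(* Here the hypotheses are contradictory: single-valuedness would give [None = Some y]. *)
by have := equicontinuous_single_valued eqc clR Rxy Rxo.
Qed.

(** By totality [S] has a point over [x]. If it is finite, [R] shares it, so [(Some x, None)] is a
    limit of finite points of [R]. These lie in [S], which is closed. *)
Lemma sub_at_infty R S x :
  topologically_equicontinuous (range theta) \/ locally_connected X ->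
  clA R -> clA S -> R `&` finite_part X = S `&` finite_part X ->
  hyperset R (Some x, None) -> hyperset S (Some x, None).
Proof.
move=> ab clR clS RS Rxo.
have [[y|] //] := graph_closure_total (Some x : alpha X)
  (@one_point_compactification_compact X) clS.
move=> Sxy; have [Rxy _] : (R `&` finite_part X) (Some x, Some y).
  by rewrite RS; split.
apply: (@hyperset_closed _ S).
apply: (closureS (A := R `&` finite_part X)); last exact: infty_closure Rxy Rxo.
by rewrite RS => p [].
Qed.

Lemma finite_part_inj R S :
  topologically_equicontinuous (range theta) \/ locally_connected X ->
  clA R -> clA S -> R `&` finite_part X = S `&` finite_part X -> R = S.
Proof.
move=> ab; suff sub R' S' : clA R' -> clA S' ->
    R' `&` finite_part X = S' `&` finite_part X -> R' `<=` S'.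
  by move=> clR clS RS; apply: hyperspace_eq; apply/seteqP; split; exact: sub.
move=> clR clS RS [[x|] [y|]] Rxy.
- suff [] : (S' `&` finite_part X) (Some x, Some y) by [].
  by rewrite -RS; split.
- exact: (sub_at_infty ab clR clS RS).
(* A point [(None, Some y)] becomes [(Some y, None)] in the swapped sets, whose finite parts still
   agree. *)
- have := sub_at_infty ab (graph_closure_swap clR) (graph_closure_swap clS) _ Rxy.
  apply; apply/seteqP; split=> -[a b] [/= ab' [/= fa fb]]; split => //=.
    suff [] : (S' `&` finite_part X) (b, a) by [].
    by rewrite -RS.
  suff [] : (R' `&` finite_part X) (b, a) by [].
  by rewrite RS.
- exact: graph_closure_infty clS.
Qed.

Lemma pullback_inj R S :
  topologically_equicontinuous (range theta) \/ locally_connected X ->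
  clA R -> clA S -> rho R = rho S -> R = S.
Proof.
move=> ab clR clS RS; apply: finite_part_inj => //.
have E x y : hyperset R (Some x, Some y) = hyperset S (Some x, Some y).
  exact: (congr1 (fun Q => hyperset Q (x, y)) RS).
apply/seteqP; split=> -[a b] [/= Rp [/= [x _ xE] [y _ yE]]]; move: Rp;
  rewrite -xE -yE => Rp; split=> //.
  by rewrite -E.
by rewrite E.
Qed.

(** This makes the $g$-topology coarser than the one induced by the graphs in [alpha X]: each
    subbasic condition on [h] amounts to its graph missing a compact rectangle. *)
Lemma g_topology_alpha_cvg g :
  filter_from (nbhs (graph_map hA (alpha_representation theta) g))
    (fun N => graph_map hA (alpha_representation theta) @^-1` N)
  --> (g : g_topology theta).
Proof.
set i := graph_map hA (alpha_representation theta).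
have FF : Filter (filter_from (nbhs (i g)) (fun N => i @^-1` N)).
  apply: filter_from_filter; first by exists setT; exact: filterT.
  by move=> M N nM nN; exists (M `&` N) => //; exact: filterI.
apply: g_topology_cvg => K O cK oO KO gKO.
have cC (C : set X) : open C -> compact (~` (Some @` C) : set (alpha X)).
  move=> oC; apply: subclosed_compact one_point_compactification_compact _ => //.
  by apply: open_closedC; exact: one_point_compactification_open_some.
have cS (C : set X) : compact C -> compact (Some @` C : set (alpha X)).
  apply: continuous_compact; apply: continuous_subspaceT.
  exact: one_point_compactification_some_continuous.
have someE (C : set X) x : (Some @` C : set (alpha X)) (Some x) <-> C x.
  by split=> [[y Cy [<-]]//|Cx]; exists x.
(* [A] and [B] have finite parts [K] and the complement of [O]. Infinity is added only to the factor
   not assumed compact, so the point [(None, None)] common to all graphs stays outside the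
   rectangle. *)
have [A [B [cA cB AK BO AB]]] : exists A B : set (alpha X),
    [/\ compact A, compact B, forall x, A (Some x) <-> K x,
        forall x, B (Some x) <-> ~ O x & ~ (A None /\ B None)].
  case: KO => [cptK|cptO].
    exists (Some @` K), (~` (Some @` O)).
    split; [exact: cS|exact: cC|exact: someE| |by case=> -[]].
    by move=> x; split; apply: contra_not => /someE.
  exists (~` (Some @` ~` K)), (Some @` ~` O).
  split; [|exact: cS| |exact: someE|by case=> _ []].
    by apply: cC; exact: closed_openC.
  move=> x; split=> [nK|Kx /someE]; last exact.
  by apply: contrapT => Kx; apply: nK; exists x.
have KO' h : i h `&` (A `*` B) = set0 <-> theta h @` K `<=` O.
  split=> [ihAB _ [x Kx <-]|hKO].
    apply: contrapT => /BO Bhx; case/seteqP: ihAB => + _.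
    by move=> /(_ (Some x, Some (theta h x))); apply; split => //; split => //; exact/AK.
  apply/seteqP; split=> // -[[x|] b] [/= -> [/= Ax Bb]].
    by move/BO: Bb; apply; apply: hKO; exists x => //; exact/AK.
  by apply: AB.
exists [set R : hyperspace (alpha X * alpha X)%type | R `&` (A `*` B) = set0].
  apply: open_nbhs_nbhs; split; last exact/KO'.
  by apply: miss_open; exact: compact_setX.
by move=> h /= /KO'.
Qed.
Lemma g_topology_alpha_preimage (U : set (g_topology theta)) :
  open U ->
  exists2 V, open V & graph_map hA (alpha_representation theta) @^-1` V = U.
Proof.
move=> oU; set i := graph_map hA (alpha_representation theta).
(* The largest open set whose preimage lies in [U]. *)
exists (\bigcup_(V in [set V | open V /\ i @^-1` V `<=` U]) V).
  by apply: bigcup_open => V [].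
apply/seteqP; split=> [g [V [_ VU] Vg]|g Ug]; first exact: VU.
have [N nN NU] := g_topology_alpha_cvg (open_nbhs_nbhs (conj oU Ug)).
move: nN; rewrite nbhsE => -[V [oV Vg] VN]; exists V => //; split=> // h /VN.
exact: NU.
Qed.

End alpha.

Theorem theorem3p33 (G : topologicalGroupType) (X : topologicalType)
    (tG : tychonoff_space G) (tX : tychonoff_space X)
    (lcX : locally_compact [set: X])
    (theta : representation G X)
    (rep_theta : tau_g_representable theta)
    (ab : topologically_equicontinuous (range theta) \/ locally_connected X) :
  [/\ condition_ER (alpha_hausdorff lcX tX) theta,
      topological_embedding (graph_map (tychonoff_hausdorff tX) theta) &
      same_compactification
        (graph_compactification_map (alpha_hausdorff lcX tX)
           (alpha_representation theta) : G -> _)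
        (graph_compactification_map (tychonoff_hausdorff tX) theta : G -> _)].

Proof.
have [g_top [ct _]] := rep_theta.
set hA := alpha_hausdorff lcX tX; set hX := tychonoff_hausdorff tX.
set iA := graph_map hA (alpha_representation theta).
set iX := graph_map hX theta.
pose rho := pullback (@some_pair_continuous X).
have rho_i g : rho (iA g) = iX g by exact: pullback_graph_map.
have cl_i g : graph_closure hA (alpha_representation theta) (iA g).
  by apply: subset_closure; exists g.
split.
- by move=> R S clR clS RS _; exact: (finite_part_inj ab clR clS RS).
- split=> [g h gh|U].
    have hg x : theta h x = theta g x.
      have : hyperset (iX g) (x, theta g x) by [].
      by rewrite gh => /= ->.
    suff : (h^-1 * g)%g = 1%g by move=> e; rewrite -[g](mulVKg h) e mulg1.
    apply: (@rep_act_effective _ _ theta) => x.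
    by rewrite rep_actM -hg -rep_actM mulVg rep_act1.
  split=> [oU|[V oV <-]]; last first.
    by apply: open_comp oV => g _; exact: graph_map_continuous.
  have [V oV VU] := g_topology_alpha_preimage lcX tX ((g_top U).1 oU).
  (* The limits outside [V] have a closed image under [rho]. As [rho] is injective on limits, [iX g]
     avoids this image exactly when [iA g] is in [V]. *)
  exists (~` (rho @` (graph_closure hA (alpha_representation theta) `&` ~` V))).
    by apply: closed_openC; apply: pullback_closed; exact: open_closedC.
  rewrite -VU; apply/seteqP; split=> [g nVg|g Vg [R [clR nVR]]].
    by apply: contrapT => nV; apply: nVg; exists (iA g).
  rewrite -rho_i => /(pullback_inj ab clR (cl_i g)) RE.
  by apply: nVR; rewrite RE.
have rho_cl (R : set_type (graph_closure hA (alpha_representation theta))) :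
    rho (set_val R) \in graph_closure hX theta.
  apply/mem_set; rewrite -(pullback_image_closure lcX tX).
  by exists (set_val R) => //; exact: set_valP.
pose h R : set_type (graph_closure hX theta) :=
  exist _ (rho (set_val R)) (rho_cl R).
exists h; last by move=> g; apply/val_inj; exact: rho_i.
apply: compact_hausdorff_homeomorphism.
- exact/set_type_compact/graph_closure_compact.
- exact/set_type_hausdorff/hyperspace_setX_hausdorff.
- apply: (@continuous_comp_initial _ _ _ set_val h) => R.
  apply: (@continuous_comp _ _ _ set_val rho R).
    exact: (@initial_continuous _ _ set_val R).
  exact: (pullback_continuous (@some_pair_open X)).
- move=> R S /(congr1 val) /= RS; apply/val_inj.
  by apply: (pullback_inj ab) RS; exact: set_valP.
move=> S; have : (rho @` graph_closure hA (alpha_representation theta)) (set_val S).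
  by rewrite pullback_image_closure; exact: set_valP.
move=> [R clR RS]; exists (exist _ R (mem_set clR)); exact/val_inj.
Qed.
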